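(* Let $G$ be an edge-colored graph on $n$ vertices with $e(G)+c(G)\geq \binom{n}{2}+t_{n,k-2}+2$. If $n>k\geq 6$, or $k=5$ and $n\geq 10$, then $G$ contains at least two rainbow cliques $K_k$.
   Context: All graphs are finite, simple and undirected. An edge-colored graph is a graph with an arbitrary (not necessarily proper) coloring of its edges; $e(G)$ is the number of edges and $c(G)$ the number of distinct colors of $G$. A rainbow clique $K_k$ is a complete subgraph on $k$ vertices whose edges have pairwise distinct colors. The Turán graph $T_{n,r}$ is the complete $r$-partite graph on $n$ vertices whose part sizes differ by at most one, and $t_{n,r}$ is its number of edges. *)

(* Defs.v *)
From mathcomp Require Import all_boot.
Set Implicit Arguments.
Unset Strict Implicit.
Unset Printing Implicit Defensive.

Record sgraph (T : finType) := SGraph {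
  adj :> rel T;
  adj_sym : symmetric adj;
  adj_irrefl : irreflexive adj
}.

Definition edges (T : finType) (G : sgraph T) : {set {set T}} :=
  [set [set p.1; p.2] | p : T * T & adj G p.1 p.2].

(* A coloring is a total function on vertex sets; only its values on
   [edges G] are ever inspected, and it need not be proper. *)
Definition coloring (T : finType) (C : Type) := {set T} -> C.

Definition num_colors (T : finType) (C : eqType) (G : sgraph T)
    (col : coloring T C) : nat :=
  size (undup [seq col e | e in edges G]).

Definition clique (T : finType) (G : sgraph T) (S : {set T}) : bool :=
  [forall x in S, forall y in S, (x != y) ==> adj G x y].

Definition rainbow_clique (T : finType) (C : eqType) (G : sgraph T)
    (col : coloring T C) (k : nat) (S : {set T}) : bool :=
  [&& #|S| == k, clique G S
    & dinjectiveb col [set e in edges G | e \subset S]].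

Definition turan_rel (n r : nat) : rel 'I_n := fun i j => i %% r != j %% r.

Lemma turan_sym n r : symmetric (@turan_rel n r).
Proof. by move=> i j; rewrite /turan_rel eq_sym. Qed.

Lemma turan_irrefl n r : irreflexive (@turan_rel n r).
Proof. by move=> i; rewrite /turan_rel eqxx. Qed.

(* The parts are the residue classes modulo r; [turan_parts_balanced] below
   shows that their sizes differ by at most one. *)
Definition turan_graph (n r : nat) : sgraph 'I_n :=
  SGraph (@turan_sym n r) (@turan_irrefl n r).

Definition turan_number (n r : nat) : nat := #|edges (turan_graph n r)|.

Lemma card_turan_part n r i : i < r ->
  #|[set x : 'I_n | x %% r == i]| = (n + (r.-1 - i)) %/ r.
Proof.
move=> lt_ir; have r_gt0 : 0 < r by apply: leq_ltn_trans lt_ir.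
have Dr : (r.-1 - i).+1 = r - i by rewrite -subSn ?prednK // -ltnS prednK.
rewrite -sum1_card (eq_bigl (fun x : 'I_n => x %% r == i));
  last by move=> x; rewrite inE.
rewrite big_mkcond; elim: n => [|n IHn].
  by rewrite big_ord0 divn_small // add0n Dr leq_subr.
rewrite big_ord_recr /= IHn addSn divnS // addnC -addnS Dr.
congr (_ + _).
have -> : (r %| n + (r - i)) = (n %% r == i); last by case: eqP.
rewrite -[X in _ == X](modn_small lt_ir).
by rewrite -(eqn_modDr (r - i)) subnKC 1?ltnW // modnn.
Qed.

Lemma turan_parts_balanced n r i j : i < r -> j < r ->
  #|[set x : 'I_n | x %% r == i]| <= #|[set x : 'I_n | x %% r == j]|.+1.
Proof.
move=> lt_ir lt_jr; rewrite !card_turan_part //.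
have r_gt0 : 0 < r by apply: leq_ltn_trans lt_ir.
have <- : (n + (r.-1 - j) + r) %/ r = ((n + (r.-1 - j)) %/ r).+1.
  by rewrite divnDr ?dvdnn // divnn r_gt0 addn1.
rewrite leq_div2r // -addnA leq_add2l.
by rewrite (leq_trans (leq_subr _ _)) // (leq_trans (leq_pred r)) ?leq_addl.
Qed.

(* Main.v *)
Require Import Defs.
From mathcomp Require Import all_boot zify.
Set Implicit Arguments.
Unset Strict Implicit.
Unset Printing Implicit Defensive.

(* Put r = k - 2 and m = (n-1)/r - 1, and induct on the vertex set, deleting a
   vertex while the bound survives, down to r + 3 vertices, where at most one
   colour is repeated. If no vertex can be deleted, then for each v the number
   of neighbours of v plus the number of colour classes that are stars centred
   at v is at least 2(n-1) - m. Pick one edge v -> u in each such class: picked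
   edges have distinct colours, and v misses at most m targets. Greedily there
   is a clique K of r + 1 vertices joined by picked edges. Counting the misses
   at K, more than (r-1)m vertices x outside K are dominated by all of K but one
   y, and either x extends K to a rainbow clique or the colour of yx is repeated
   on a picked edge y -> z with z in K. If the pairs {y, z} and {y', z'} of two
   such vertices x, x' meet in w and x x' is picked, then K - w + x + x' is a
   rainbow clique (taking w = y if y = y'). Otherwise each w in K lies in at
   most m of the pairs, which contradicts the count, as K also misses z -> y.
   Starting K at a vertex outside a given rainbow clique S0 forces a clique
   different from S0, at the cost of discarding one vertex x in S0. *)

(** * Rainbow vertex sets and elementary counts *)

Definition rainbow (T : finType) (C : eqType) (G : sgraph T)
    (col : coloring T C) (S : {set T}) : Prop :=
  {in S &, forall a b, a != b -> G a b} /\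
  forall a b c d, a \in S -> b \in S -> c \in S -> d \in S ->
    G a b -> G c d -> col [set a; b] = col [set c; d] ->
    [set a; b] = [set c; d].

Lemma set2_or (T : finType) (x y a b : T) : [set a; b] = [set x; y] ->
  (a = x /\ b = y) \/ (a = y /\ b = x).
Proof.
move=> E.
have : a \in [set x; y] by rewrite -E set21.
have : b \in [set x; y] by rewrite -E set22.
have : x \in [set a; b] by rewrite E set21.
have : y \in [set a; b] by rewrite E set22.
rewrite !inE.
move=> /orP[] /eqP ? /orP[] /eqP ? /orP[] /eqP ? /orP[] /eqP ?; subst; auto.
Qed.

Lemma adj_neq (T : finType) (G : sgraph T) a b : G a b -> a != b.
Proof. by apply: contraTneq => ->; rewrite adj_irrefl. Qed.

Lemma leq_card_bigcup (I J : finType) (K : {set I}) (F : I -> {set J}) b :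
  {in K, forall i, #|F i| <= b} -> #|\bigcup_(i in K) F i| <= #|K| * b.
Proof.
move=> Fb; apply: (@leq_trans (\sum_(i in K) #|F i|)).
  elim/big_rec2: _ => [|i a B iK le_ba]; first by rewrite cards0.
  by rewrite (leq_trans (leq_card_setU _ _)) // leq_add2l.
by rewrite -sum_nat_const; apply: leq_sum => i /Fb.
Qed.

Lemma card_setD1D (T : finType) (W A : {set T}) v : v \in W -> A \subset W -> v \notin A ->
  #|W :\: A :\ v| + #|A| = #|W|.-1.
Proof.
move=> vW AW vA; have := cardsD1 v (W :\: A); have := cardsID A W.
rewrite (setIidPr AW) inE vW vA /=; lia.
Qed.

Lemma sum_card_exchange (I J : finType) (A : {set I}) (B : {set J}) (R : I -> J -> bool) :
  \sum_(i in A) #|[set j in B | R i j]| = \sum_(j in B) \sum_(i in A) R i j.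
Proof.
rewrite exchange_big /=; apply: eq_bigr => i _.
by rewrite -sum1dep_card big_mkcondr; apply: eq_bigr => j _; case: R.
Qed.

(** * Star colour classes and the colours of picked edges *)

Section StarOrientation.

Variables (T : finType) (C : eqType) (G : sgraph T) (col : coloring T C).
(* [O v] picks one edge [v u] from every colour class on [W] that is a star
   centred at [v]. *)
Variables (W : {set T}) (O : T -> {set T}).

Hypothesis O_adj : forall v u, u \in O v -> [/\ v \in W, u \in W & G v u].
Hypothesis O_star : forall v u a b, u \in O v -> a \in W -> b \in W -> G a b ->
  col [set a; b] = col [set v; u] -> v \in [set a; b].
Hypothesis O_inj : forall v u u', u \in O v -> u' \in O v ->
  col [set v; u] = col [set v; u'] -> u = u'.

Definition arc a b := (b \in O a) || (a \in O b).

Lemma arcC a b : arc a b = arc b a.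
Proof. by rewrite /arc orbC. Qed.

Lemma arc_adj a b : arc a b -> G a b.
Proof.
by case/orP => /O_adj [_ _ //]; rewrite adj_sym.
Qed.

Lemma O_neq v u : u \in O v -> u != v.
Proof.
by case/O_adj => _ _ /adj_neq; rewrite eq_sym.
Qed.

(** If the tails [a] and [c] differ, the star property puts [c] on the edge [ab] and [a] on the edge
    [cd], so both edges are [{a, c}]. *)
Lemma out_color_inj a b c d : b \in O a -> d \in O c ->
  col [set a; b] = col [set c; d] -> [set a; b] = [set c; d].
Proof.
move=> ab cd E; have [aW bW Gab] := O_adj ab; have [cW dW Gcd] := O_adj cd.
have [eac|nac] := eqVneq a c.
  by rewrite -eac in cd E *; rewrite (O_inj ab cd E).
have := O_star cd aW bW Gab E; have := O_star ab cW dW Gcd (esym E).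
rewrite !inE [c == a]eq_sym (negPf nac) /= => /eqP -> /eqP ->.
by rewrite setUC.
Qed.

Lemma arc_color_inj a b c d : arc a b -> arc c d ->
  col [set a; b] = col [set c; d] -> [set a; b] = [set c; d].
Proof.
case/orP => [ab|ba]; case/orP => [cd|dc]; first exact: out_color_inj.
- by rewrite [[set c; d]]setUC; apply: out_color_inj.
- by rewrite [[set a; b]]setUC; apply: out_color_inj.
- by rewrite [[set a; b]]setUC [[set c; d]]setUC; apply: out_color_inj.
Qed.

(** Two arcs of one colour already coincide by [arc_color_inj], so only pairs of edges that include
    a non-arc remain to be checked. *)
Lemma rainbow_nonarc (S : {set T}) :
    {in S &, forall a b, a != b -> G a b} ->
    (forall a b c d, a \in S -> b \in S -> c \in S -> d \in S ->
      G a b -> G c d -> ~~ arc a b -> col [set a; b] = col [set c; d] ->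
      [set a; b] = [set c; d]) ->
  rainbow G col S.
Proof.
move=> adjS naS; split=> // a b c d aS bS cS dS Gab Gcd E.
have [ab|] := boolP (arc a b); last by move=> nab; apply: naS.
have [cd|ncd] := boolP (arc c d); first exact: arc_color_inj.
by apply/esym/naS.
Qed.

(** * Arc cliques: extension by one vertex, exchange, greedy growth *)

Definition arc_clique (K : {set T}) :=
  K \subset W /\ {in K &, forall a b, a != b -> arc a b}.

(* The colour of the only non-arc [y x] of [x |: K] is repeated on an arc from
   [y] to some [z] in [K], since colours of other arcs are stars elsewhere. *)
Definition blocked (K : {set T}) (x y z : T) :=
  [/\ [/\ x \in W, x \notin K, y \in K & z \in K],
      [/\ z \in O y, y \notin O z, ~~ arc y x & G y x],
      {in K, forall u, u != y -> x \in O u}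
    & col [set y; x] = col [set y; z] ].

(** All pairs of [x |: K] except possibly [yx] are arcs. If [yx] is not, an arc [u -> w] of its
    colour has its centre [u] on [yx]. For [u = y] the vertex [x] is blocked; for [u = x] the edge
    [w -> x] is picked as well, and its class, a star at [w], cannot contain [yx]. *)
Lemma blocked_or_rainbow K x y : arc_clique K -> x \in W -> x \notin K ->
    y \in K -> G y x -> {in K, forall u, u != y -> x \in O u} ->
  rainbow G col (x |: K) \/ exists z, blocked K x y z.
Proof.
move=> [KW cK] xW xK yK Gyx xO.
have KWs : {in K, forall u, u \in W} by apply/subsetP.
have yx : y != x by apply: contraNneq xK => <-.
have SW : {in x |: K, forall u, u \in W}.
  by move=> u /setU1P[->|/KWs].
have ux : {in K, forall u, u == x = false}.
  by move=> u uK; apply: contraNF xK => /eqP <-.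
have cS : {in x |: K &, forall a b, a != b ->
    arc a b \/ [set a; b] = [set y; x]}.
  move=> a b /setU1P[->|aK] /setU1P[->|bK]; rewrite ?eqxx // => nab.
  - have [->|nby] := eqVneq b y; first by right; rewrite setUC.
    by left; rewrite /arc xO ?orbT.
  - have [->|nay] := eqVneq a y; first by right.
    by left; rewrite /arc xO.
  - by left; apply: cK.
have GS : {in x |: K &, forall a b, a != b -> G a b}.
  move=> a b aS bS nab; case: (cS a b aS bS nab) => [/arc_adj //|].
  by case/set2_or=> [[-> ->]//|[-> ->]]; rewrite adj_sym.
have [yxarc|nyx] := boolP (arc y x).
  left; apply: rainbow_nonarc => // a b c d aS bS cS' dS Gab Gcd nab.
  have nab' := adj_neq Gab.
  case: (cS a b aS bS nab') => [abarc|/set2_or[[ea eb]|[ea eb]]].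
  - by rewrite abarc in nab.
  - by rewrite ea eb yxarc in nab.
  - by rewrite ea eb arcC yxarc in nab.
pose bz z := [&& z \in K, z \in O y & col [set y; x] == col [set y; z]].
have [/existsP[z /and3P[zK zO /eqP E]]|] := boolP [exists z, bz z].
  right; exists z; split=> //; split=> //.
  (* Were [z -> y] picked too, the class would be a star centred at [z], yet it contains [yx]. *)
  apply: contraT; rewrite negbK => yOz.
  have := O_star yOz (KWs _ yK) xW Gyx; rewrite [[set z; y]]setUC => /(_ E).
  by rewrite !inE (negPf (O_neq zO)) /= ux.
rewrite negb_exists => /forallP nbz; left.
apply: rainbow_nonarc => // a b c d aS bS cS' dS Gab Gcd nab.
have nab' := adj_neq Gab.
have ncd' := adj_neq Gcd.
have -> : [set a; b] = [set y; x].
  by case: (cS a b aS bS nab') => // h; rewrite h in nab.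
have nout u w : u \in x |: K -> w \in x |: K -> w \in O u ->
    col [set y; x] = col [set u; w] -> False.
  move=> uS wS wOu E.
  have := O_star wOu (KWs _ yK) xW Gyx E.
  rewrite !inE => /orP[] /eqP eu; subst u.
    have wx : w != x.
      by apply: contraNneq nyx => <-; rewrite /arc wOu.
    move: wS; rewrite !inE (negPf wx) /= => wK.
    by have := nbz w; rewrite /bz wK wOu E eqxx.
  have wx := O_neq wOu.
  move: wS; rewrite !inE (negPf wx) /= => wK.
  have wy : w != y by apply: contraNneq nyx => <-; rewrite /arc wOu orbT.
  have := O_star (xO w wK wy) (KWs _ yK) xW Gyx.
  rewrite E [[set w; x]]setUC => /(_ erefl).
  by rewrite !inE (negPf wx) orbF (negPf wy).
move=> E; case: (cS c d cS' dS ncd') => [/orP[cd|dc]|->] //.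
  by case: (nout c d).
by case: (nout d c) => //; rewrite E [[set c; d]]setUC.
Qed.

(** The class of [yx] is a star at [y] that contains [y -> z], so once [z] is removed no arc of the
    new set has this colour. The pairs [yx] and [y'x'] can share a colour only if [y = y']; the last
    hypothesis then removes [y] itself, and neither pair survives. *)
Lemma exchange_rainbow K x y z x' y' z' w : arc_clique K ->
    blocked K x y z -> blocked K x' y' z' -> arc x x' ->
    w \in [set y; z] -> w \in [set y'; z'] -> (y = y' -> w = y) ->
  rainbow G col (x |: (x' |: (K :\ w))).
Proof.
move=> [KW cK] bx bx' xx' wyz wyz' yyw.
have KWs : {in K, forall u, u \in W} by apply/subsetP.
have nxx' := adj_neq (arc_adj xx').
set S := _ |: _.
have [[xW xK _ _] _ _ _] := bx; have [[xW' xK' _ _] _ _ _] := bx'.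
have SW : {in S, forall u, u \in W}.
  by move=> u /setU1P[->|/setU1P[->|/setD1P[_ /KWs]]].
have pair_case t yt zt u : blocked K t yt zt -> w \in [set yt; zt] ->
    u \in K -> u != w -> arc u t \/ [/\ u = yt, w = zt & G u t].
  move=> [[tW tK yK zK] [zO yO nyt Gyt] tO _] wt uK uw.
  have [euy|nuy] := eqVneq u yt; last by left; rewrite /arc tO.
  subst u; right; move: wt; rewrite !inE eq_sym (negPf uw) /= => /eqP -> //.
(* every non-arc of [S] is [y x] or [y' x'], and then [w] is [z] or [z'] *)
have cS : {in S &, forall a b, a != b -> [\/ arc a b,
    [/\ [set a; b] = [set y; x], w = z & G y x] |
    [/\ [set a; b] = [set y'; x'], w = z' & G y' x']]}.
  move=> a b /setU1P[->|/setU1P[->|/setD1P[aw aK]]]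
             /setU1P[->|/setU1P[->|/setD1P[bw bK]]];
    rewrite ?eqxx // => nab; try by constructor 1.
  - case: (pair_case _ _ _ _ bx wyz bK bw) => [|[-> ? ?]].
      by rewrite arcC; constructor 1.
    by constructor 2; rewrite setUC.
  - by constructor 1; rewrite arcC.
  - case: (pair_case _ _ _ _ bx' wyz' bK bw) => [|[-> ? ?]].
      by rewrite arcC; constructor 1.
    by constructor 3; rewrite setUC.
  - case: (pair_case _ _ _ _ bx wyz aK aw) => [|[-> ? ?]]; by [constructor 1|constructor 2].
  - case: (pair_case _ _ _ _ bx' wyz' aK aw) => [|[-> ? ?]]; by [constructor 1|constructor 3].
  - by constructor 1; apply: cK.
have GS : {in S &, forall a b, a != b -> G a b}.
  move=> a b aS bS nab; case: (cS a b aS bS nab) => [/arc_adj //|[]|[]];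
  by case/set2_or=> [[-> ->]//|[-> ->]]; rewrite adj_sym.
have special t yt zt c d : blocked K t yt zt -> w = zt ->
    c \in S -> d \in S -> arc c d -> col [set yt; t] = col [set c; d] -> False.
  move=> [[tW tK yK zK] [zO yO nyt Gyt] tO E1] ew cS' dS cd E.
  have out u v : u \in S -> v \in S -> v \in O u ->
      col [set u; v] = col [set yt; zt] -> False.
    move=> uS vS vu E2.
    have [euy|nuy] := eqVneq u yt.
      subst u; have ev := O_inj vu zO E2; move: vS.
      rewrite ev -ew /S !inE eqxx /= ew orbF => /orP[] /eqP ez.
        by rewrite ez (negPf xK) in zK.
      by rewrite ez (negPf xK') in zK.
    (* A tail [u] other than [yt] would be the centre of the star, hence lie on both [{yt, t}] and
       [{yt, zt}]. *)
    have := O_star vu (KWs _ yK) tW Gyt (etrans E1 (esym E2)).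
    have := O_star vu (KWs _ yK) (KWs _ zK) (let: And3 _ _ h := O_adj zO in h)
              (esym E2).
    rewrite !inE (negPf nuy) /= => /eqP -> /eqP ez.
    by rewrite ez (negPf tK) in zK.
  rewrite E in E1; case/orP: cd => [cd|dc]; first exact: (out c d).
  by apply: (out d c) => //; rewrite [[set d; c]]setUC.
have same t yt zt t' yt' zt' : blocked K t yt zt -> blocked K t' yt' zt' ->
    w = zt -> w = zt' -> t != t' -> (yt = yt' -> w = yt) ->
    col [set yt; t] = col [set yt'; t'] -> False.
  move=> [[tW tK yK zK] [zO yO nyt Gyt] tO E1]
         [[tW' tK' yK' zK'] [zO' yO' nyt' Gyt'] tO' E1'] ew ew' ntt' yw E.
  have zy := O_neq zO.
  have := O_star zO (KWs _ yK') tW' Gyt' (etrans (esym E) E1).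
  rewrite !inE => /orP[] /eqP ey.
    by move: zy; rewrite -(yw ey) ew eqxx.
  by rewrite -ey yK in tK'.
apply: rainbow_nonarc => // a b c d aS bS cS' dS Gab Gcd nab.
have nab' := adj_neq Gab.
have ncd' := adj_neq Gcd.
move=> E.
case: (cS a b aS bS nab') => [h|[-> h1 h2]|[-> h1 h2]] in E *.
- by rewrite h in nab.
- case: (cS c d cS' dS ncd') => [cd|[-> _ _] //|[ecd h3 h4]].
    by case: (special _ _ _ _ _ bx h1 cS' dS cd).
  rewrite ecd in E; by case: (same _ _ _ _ _ _ bx bx').
- case: (cS c d cS' dS ncd') => [cd|[ecd h3 h4]|[-> _ _] //].
    by case: (special _ _ _ _ _ bx' h1 cS' dS cd).
  rewrite ecd in E; case: (same _ _ _ _ _ _ bx' bx) => //.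
    by rewrite eq_sym.
  by move=> e; rewrite e; apply: yyw.
Qed.

(** Greedy growth: each [y] in [K] excludes at most [b] candidates, itself among them since [y] is
    not in [O y], so as long as [K] has at most [r] vertices some candidate is dominated by all of
    [K]. *)
Lemma arc_clique_extend v r b : v \in W -> r * b < #|W| ->
    {in W, forall y, #|W :\: O y| <= b} ->
  exists K : {set T}, [/\ v \in K, #|K| = r.+1 & arc_clique K].
Proof.
move=> vW rb Ob.
elim: r rb => [|r IHr] rb.
  exists [set v]; rewrite set11 cards1; split=> //; split; first by rewrite sub1set.
  by move=> a c /set1P -> /set1P ->; rewrite eqxx.
have [|K [vK cK [KW aK]]] := IHr; first by rewrite mulSn in rb; lia.
have : #|\bigcup_(y in K) (W :\: O y)| < #|W|.
  apply: leq_ltn_trans rb; rewrite -cK; apply: leq_card_bigcup => y yK.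
  exact/Ob/(subsetP KW).
rewrite ltnNge => /negP h.
have [x xW xn] : exists2 x, x \in W & x \notin \bigcup_(y in K) (W :\: O y).
  by apply/subsetPn/negP => /subset_leq_card.
have xO : {in K, forall y, x \in O y}.
  move=> y yK; apply: contraR xn => nx; apply/bigcupP; exists y => //.
  by rewrite inE nx.
have xK : x \notin K by apply/negP => xK; have := O_neq (xO _ xK); rewrite eqxx.
exists (x |: K); rewrite setU1r // cardsU1 xK cK; split=> //; split.
  by rewrite subUset sub1set xW.
move=> a c /setU1P[->|aI] /setU1P[->|cI]; rewrite ?eqxx // => nac.
- by rewrite /arc (xO c) ?orbT.
- by rewrite /arc (xO a).
- exact: aK.
Qed.

(** * Counting misses when no vertex can be deleted *)

Definition nbr v := [set u in W | G v u].

Lemma nbr_subW v : nbr v \subset W.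
Proof. by apply/subsetP => u; rewrite inE => /andP[]. Qed.

Section Counting.

(** The induction step takes [m.+1] and [s] as quotient and remainder of [#|W|.-1] by [r]; [defect]
    is what the failure of every deletion yields. *)
Variables (r m s : nat).
Hypothesis r_ge3 : 2 < r.
Hypothesis cardW : #|W| = (r * m.+1 + s).+1.
Hypothesis ms_gt0 : 0 < m + s.
Hypothesis defect : {in W, forall v, 2 * #|W|.-1 <= #|nbr v| + #|O v| + m}.

Lemma O_subW v : O v \subset W.
Proof. by apply/subsetP => u /O_adj[]. Qed.

Lemma card_non_out v : v \in W ->
  #|W :\: O v :\ v| + #|W :\: nbr v :\ v| <= m.
Proof.
move=> vW; have := defect vW.
have vO : v \notin O v by apply/negP => /O_neq; rewrite eqxx.
have vN : v \notin nbr v by rewrite inE adj_irrefl andbF.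
have := card_setD1D vW (O_subW v) vO.
have := card_setD1D vW (nbr_subW v) vN; lia.
Qed.

(** [x] misses [X :\ x] and also [y]; this extra miss makes up for the removed [x], so the bound is
    [m] and not [m.+1]. *)
Lemma indep_card (X : {set T}) x y : x \in W -> x \in X -> X \subset W ->
  {in X, forall u, u != x -> ~~ arc x u} -> y \in W -> y \notin X ->
  y \notin O x -> #|X| <= m.
Proof.
move=> xW xX XW nX yW yX yO.
have /subset_leq_card : y |: (X :\ x) \subset W :\: O x :\ x.
  apply/subsetP => u; rewrite !inE => /orP[/eqP ->|/andP[ux uX]].
    by rewrite yW yO !andbT; apply: contraNneq yX => ->.
  by rewrite ux (subsetP XW) //= andbT; have := nX u uX ux; rewrite negb_or => /andP[].
rewrite cardsU1 !inE (negPf yX) andbF /=.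
have := cardsD1 x X; rewrite xX; have := card_non_out xW; lia.
Qed.

(* A pair missing from [G] counts twice, like a missing edge in the defect. *)
Definition nondom (K : {set T}) x :=
  \sum_(y in K) ((x \notin O y) + (x \notin nbr y)).

Lemma nondom0 (K : {set T}) x : nondom K x = 0 -> {in K, forall y, x \in O y}.
Proof.
move=> /eqP; rewrite sum_nat_eq0 => /forall_inP h y /h.
by rewrite addn_eq0 !eqb0 negbK => /andP[].
Qed.

Lemma nondom1 (K : {set T}) x : nondom K x = 1 -> exists y,
  [/\ y \in K, x \notin O y, x \in nbr y & {in K, forall u, u != y -> x \in O u}].
Proof.
move=> h.
have [/exists_inP[y yK xy]|] := boolP [exists y in K, x \notin O y]; last first.
  rewrite negb_exists_in => /forall_inP h'.
  move: h; rewrite /nondom big1 // => y yK; have := h' y yK; rewrite negbK => xO.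
  by rewrite xO inE; case/O_adj: xO => _ -> ->.
move: h; rewrite /nondom (bigD1 y) //= xy add1n addSn => -[] /eqP.
rewrite addn_eq0 eqb0 negbK sum_nat_eq0 => /andP[xN /forallP h].
exists y; split=> // u uK uy; have := h u; rewrite uK uy /=.
by rewrite addn_eq0 eqb0 negbK => /andP[].
Qed.

(** Each [y] in [K] has at most [m] misses to spend. Those inside [K] are recorded separately,
    because the final inequality needs two of them. *)
Lemma nondom_count (K : {set T}) : K \subset W -> #|K| = r.+1 ->
  \sum_(x in W :\: K) nondom K x + \sum_(y in K) #|K :\: O y :\ y| <= r.+1 * m.
Proof.
move=> KW cK; rewrite -cK -sum_nat_const.
have -> : \sum_(x in W :\: K) nondom K x =
    \sum_(y in K) (#|[set x in W :\: K | x \notin O y]| +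
                   #|[set x in W :\: K | x \notin nbr y]|).
  rewrite big_split /= !sum_card_exchange -big_split /=.
  by apply: eq_bigr => x _; rewrite -big_split.
rewrite -big_split /=; apply: leq_sum => y yK.
have yW := subsetP KW _ yK; apply: leq_trans (card_non_out yW).
rewrite addnAC; apply: leq_add.
  rewrite -(cardsID K (W :\: O y :\ y)) addnC leq_eqVlt; apply/orP; left; apply/eqP.
  congr (_ + _); apply: eq_card => x; rewrite !inE.
    have := subsetP KW x; case: (x \in K) => [->|_] //=; last by rewrite !andbF.
    by rewrite !andbT.
  have [->|xy] := eqVneq x y; first by rewrite yK.
  by case: (x \in K); rewrite //= andbC.
apply/subset_leq_card/subsetP => x; rewrite !inE => /andP[/andP[xK xW] h].
by rewrite h xW !andbT; apply: contraNneq xK => ->.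
Qed.

Lemma unique_rainbow_contra (S0 : {set T}) v : v \in W -> v \notin S0 ->
  (forall S : {set T}, S \subset W -> #|S| = r.+2 -> rainbow G col S -> S = S0) ->
  False.
Proof.
move=> vW vS0 uniqS.
have [K [vK cK aK]] : exists K : {set T}, [/\ v \in K, #|K| = r.+1 & arc_clique K].
  apply: (@arc_clique_extend v r m.+1) => // [|y yW]; first by rewrite cardW; lia.
  have := card_non_out yW; have := cardsD1 y (W :\: O y).
  by case: (_ \in _) => /=; lia.
have [KW _] := aK.
have KWs : {in K, forall u, u \in W} by apply/subsetP.
have noU x : x \in W -> x \notin K -> rainbow G col (x |: K) -> False.
  move=> xW xK /uniqS e; move: vS0; rewrite -e ?setU1r //.
    by rewrite subUset sub1set xW.
  by rewrite cardsU1 xK cK.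
pose Y := [set x in W :\: K | nondom K x == 1].
have nd0 x : x \in W :\: K -> 0 < nondom K x.
  rewrite inE => /andP[xK xW]; rewrite lt0n; apply/eqP => /nondom0 h.
  have yK := vK; have Gy : G v x by case/O_adj: (h _ yK).
  case: (blocked_or_rainbow aK xW xK yK Gy); first by move=> u uK _; apply: h.
    exact: noU.
  by case=> z [_ [_ _ /negP[]]]; rewrite /arc h.
have YP x : x \in Y -> exists y z, blocked K x y z.
  rewrite !inE => /andP[/andP[xK xW] /eqP /nondom1 [y [yK _ xN xO]]].
  have Gy : G y x by move: xN; rewrite inE => /andP[].
  exists y; case: (blocked_or_rainbow aK xW xK yK Gy xO) => //.
  by move/(noU x xW xK).
have [f fP] : exists f : T -> T * T, forall x, x \in Y -> blocked K x (f x).1 (f x).2.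
  apply: (@fin_all_exists _ (fun=> (T * T)%type)
            (fun x u => x \in Y -> blocked K x u.1 u.2)) => x.
  have [xY|] := boolP (x \in Y); last by exists (x, x).
  by have [y [z h]] := YP x xY; exists (y, z).
pose P := \sum_(y in K) #|K :\: O y :\ y|.
have cWK : #|W :\: K| = r * m + s.
  have := cardsID K W; rewrite (setIidPr KW) cK cardW mulnS; lia.
(* Every [x] outside [K] has [nondom] at least one, and at least two unless it lies in [Y]. *)
have cY : 2 * (r * m + s) + P <= #|Y| + r.+1 * m.
  apply: leq_trans (leq_add (leqnn _) (nondom_count KW cK)).
  rewrite addnA leq_add2r -cWK mulnC -sum_nat_const.
  have -> : #|Y| = \sum_(x in W :\: K) (nondom K x == 1).
    rewrite -sum1dep_card big_mkcondr.
    by apply: eq_bigr => x _; case: (_ == 1).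
  rewrite -big_split /=; apply: leq_sum => x /nd0.
  by case: (nondom K x) => [|[|?]].
rewrite (mulSn r) in cY.
have rm : 3 * m <= r * m by rewrite leq_mul2r r_ge3 orbT.
have [x1 x1Y] : exists x, x \in Y.
  by apply/set0Pn; rewrite -card_gt0; move: rm ms_gt0 cY; clear; lia.
have f1 x : x \in Y -> (f x).1 \in K /\ (f x).2 \in K.
  by move=> /fP[[]].
have nYK x : x \in Y -> x \notin K by rewrite !inE => /andP[/andP[]].
have YW : {in Y, forall x, x \in W} by move=> x; rewrite !inE => /andP[/andP[]].
have f_nO x : x \in Y -> (f x).1 \notin O x.
  by case/fP => _ [_ _ + _] _ _; rewrite negb_or => /andP[].
(* An exchange that adds [x] and [x'] and yields [S0] forces [S0 :\: K] to be [{x, x'}], so dropping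
   one vertex of [S0 :\: K] from [Y] rules it out. The default [v] lies in [K], hence outside
   [Y]. *)
pose x0 := odflt v [pick x in S0 :\: K].
pose Y' := Y :\ x0.
have Y'Y x : x \in Y' -> x \in Y by case/setD1P.
have cY' : #|Y| <= #|Y'|.+1 by rewrite (cardsD1 x0); case: (_ \in _).
have YnonarcP x x' w : x \in Y' -> x' \in Y' ->
    w \in [set (f x).1; (f x).2] -> w \in [set (f x').1; (f x').2] ->
    ~~ arc x x'.
  move=> xY' x'Y' wx wx'; apply/negP => xx'.
  have xY := Y'Y _ xY'; have x'Y := Y'Y _ x'Y'.
  have [b b'] := (fP _ xY, fP _ x'Y).
  (* If both vertices have the same [y], [exchange_rainbow] demands that this [y] be removed,
     whatever [w] is. *)
  have [w' [wK w1 w2 w3]] : exists w', [/\ w' \in K, w' \in [set (f x).1; (f x).2],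
      w' \in [set (f x').1; (f x').2] & (f x).1 = (f x').1 -> w' = (f x).1].
    have [e|ne] := eqVneq (f x).1 (f x').1.
      by exists (f x).1; rewrite !inE e !eqxx; split=> //; case: (f1 _ x'Y).
    exists w; split=> //; first by case: (f1 _ xY) => ? ?; case/set2P: wx => ->.
    by move=> e; rewrite e eqxx in ne.
  have := exchange_rainbow aK b b' xx' w1 w2 w3.
  have nxx' := adj_neq (arc_adj xx').
  move/uniqS => eS.
  have {}eS : x |: (x' |: K :\ w') = S0.
    apply: eS.
      rewrite !subUset !sub1set !YW //=; exact: subset_trans (subD1set _ _) KW.
    rewrite !cardsU1 !inE (negPf nxx') (negPf (nYK _ xY)) (negPf (nYK _ x'Y)).
    by rewrite !andbF /= -cK (cardsD1 w' K) wK.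
  have : x0 \in [set x; x'].
    rewrite /x0; case: pickP => [t|/(_ x)] /=.
      rewrite -eS !inE => /andP[tK]; rewrite (negPf tK) andbF orbF //.
    by rewrite -eS !inE eqxx (nYK _ xY).
  move: xY' x'Y'; rewrite !inE => /andP[+ _] /andP[+ _].
  by rewrite ![_ == x0]eq_sym => /negPf -> /negPf ->.
have cX (X : {set T}) w : X \subset Y' ->
    {in X, forall x, w \in [set (f x).1; (f x).2]} -> #|X| <= m.
  move=> XY' Xw; have [->|/set0Pn[x xX]] := eqVneq X set0; first by rewrite cards0.
  have XY : {in X, forall u, u \in Y} by move=> u /(subsetP XY') /Y'Y.
  apply: (@indep_card X x (f x).1) => //.
  - exact/YW/XY.
  - by apply/subsetP => u /XY /YW.
  - move=> u uX _; apply: (YnonarcP x u w); rewrite ?Xw //; by apply: (subsetP XY').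
  - exact: (KWs _ (f1 _ (XY _ xX)).1).
  - by apply/negP => /XY /nYK; rewrite (f1 _ (XY _ xX)).1.
  - exact: (f_nO _ (XY _ xX)).
have Pf x : x \in Y -> (f x).1 \in K :\: O (f x).2 :\ (f x).2.
  move=> xY; have [[_ _ yK zK] [zO yO _ _] _ _] := fP x xY.
  by rewrite !inE yO yK eq_sym (O_neq zO).
have m_gt0 : 0 < m.
  rewrite -(cards1 x1); apply: (@indep_card [set x1] x1 (f x1).1); rewrite ?set11 //.
  - exact: (YW _ x1Y).
  - by rewrite sub1set YW.
  - by move=> u /set1P ->; rewrite eqxx.
  - exact: (KWs _ (f1 _ x1Y).1).
  - by apply/set1P => e; have := nYK _ x1Y; rewrite -e (f1 _ x1Y).1.
  - exact: f_nO.
(* For [r = 3] and [s = 0] the final inequality has no slack left for the discarded [x0], so two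
   misses inside [K] are needed. If all of [Y] had the same [y], [cX] would bound [Y'] by [m], which
   is too small; two different [y] give two misses of some [z] at [y]. *)
have P_gt1 : 1 < P.
  have [x2 x2Y ne] : exists2 x2, x2 \in Y & (f x2).1 != (f x1).1.
    apply/exists_inP; apply: contraT; rewrite negb_exists_in => /forall_inP h.
    have : #|Y'| <= m.
      apply: (cX Y' (f x1).1) => // x xY'.
      by have := h x (Y'Y _ xY'); rewrite negbK => /eqP ->; rewrite set21.
    have : 0 < P.
      rewrite /P (bigD1 (f x1).2) ?(f1 _ x1Y).2 //= ltn_addr // card_gt0.
      by apply/set0Pn; exists (f x1).1; apply: Pf.
    move: m_gt0 rm cY' cY; clear; lia.
  rewrite /P; have [e|ne2] := eqVneq (f x2).2 (f x1).2.
    rewrite (bigD1 (f x1).2) ?(f1 _ x1Y).2 //= ltn_addr //.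
    apply: (@leq_trans #|[set (f x2).1; (f x1).1]|); first by rewrite cards2 ne.
    apply/subset_leq_card/subsetP => t /set2P[->|->]; last exact: Pf.
    by rewrite -e; apply: Pf.
  rewrite (bigD1 (f x1).2) ?(f1 _ x1Y).2 //= (bigD1 (f x2).2) /=; last first.
    by rewrite (f1 _ x2Y).2.
  have : 0 < #|K :\: O (f x1).2 :\ (f x1).2|.
    by rewrite card_gt0; apply/set0Pn; exists (f x1).1; apply: Pf.
  have : 0 < #|K :\: O (f x2).2 :\ (f x2).2|.
    by rewrite card_gt0; apply/set0Pn; exists (f x2).1; apply: Pf.
  by clear; lia.
(* Double count of the incidences of [w] with [{y, z}]: each [x] has two, and each of the [r.+1]
   vertices [w] of [K] at most [m]. *)
have cYm : 2 * #|Y'| <= r.+1 * m.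
  rewrite -cK -sum_nat_const mulnC -sum_nat_const.
  apply: (@leq_trans (\sum_(w in K) #|[set x in Y' | w \in [set (f x).1; (f x).2]]|)).
    rewrite sum_card_exchange; apply: leq_sum => x /Y'Y xY.
    have [[_ _ yK zK] [zO _ _ _] _ _] := fP x xY.
    rewrite (bigD1 (f x).1) //= set21 (bigD1 (f x).2) /=; last by rewrite zK (O_neq zO).
    by rewrite set22.
  apply: leq_sum => w _; apply: (cX _ w).
    by apply/subsetP => x; rewrite inE => /andP[].
  by move=> x; rewrite inE => /andP[].
(* [cY] gives [#|Y'| >= (r - 1) * m + 1]; doubled and compared with [cYm], this leaves
   [(r - 3) * m + 2 <= 0]. *)
move: rm P_gt1 cY cY' cYm; rewrite (mulSn r); clear; lia.
Qed.

End Counting.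

End StarOrientation.

(** * Edges inside a vertex set, and Turán numbers *)

Definition edges_in (T : finType) (G : sgraph T) (W : {set T}) : {set {set T}} :=
  [set e in edges G | e \subset W].

Lemma edgesP (T : finType) (G : sgraph T) (e : {set T}) :
  reflect (exists a b, G a b /\ e = [set a; b]) (e \in edges G).
Proof.
apply: (iffP imsetP) => [[[a b]]|[a [b [Gab ->]]]].
  by rewrite inE /= => Gab ->; exists a, b.
by exists (a, b); rewrite // inE.
Qed.

Lemma mem_edges2 (T : finType) (G : sgraph T) a b :
  ([set a; b] \in edges G) = G a b.
Proof.
apply/edgesP/idP => [[c [d [Gcd]]]|Gab]; last by exists a, b.
by case/set2_or => -[-> ->]; rewrite // adj_sym.
Qed.

Lemma edges_inP (T : finType) (G : sgraph T) (W e : {set T}) :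
  reflect (exists a b, [/\ G a b, a \in W, b \in W & e = [set a; b]])
          (e \in edges_in G W).
Proof.
rewrite inE; apply: (iffP andP) => [[/edgesP[a [b [Gab ->]]]]|[a [b [Gab aW bW ->]]]].
  by rewrite subUset !sub1set => /andP[aW bW]; exists a, b.
by rewrite mem_edges2 subUset !sub1set aW bW.
Qed.

Lemma mem_edges_in2 (T : finType) (G : sgraph T) (W : {set T}) a b :
  a \in W -> b \in W -> G a b -> [set a; b] \in edges_in G W.
Proof. by move=> aW bW Gab; apply/edges_inP; exists a, b. Qed.

Lemma edges_inT (T : finType) (G : sgraph T) : edges_in G [set: T] = edges G.
Proof. by apply/setP => e; rewrite inE subsetT andbT. Qed.

Lemma edges_inD1 (T : finType) (G : sgraph T) (W : {set T}) v :
  edges_in G (W :\ v) = [set e in edges_in G W | v \notin e].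
Proof. by apply/setP => e; rewrite !inE subsetD1 andbA. Qed.

Lemma card_edges_in (T : finType) (G : sgraph T) (W : {set T}) v : v \in W ->
  #|edges_in G W| = #|edges_in G (W :\ v)| + #|nbr G W v|.
Proof.
move=> vW; rewrite -(cardsID [set e : {set T} | v \in e] (edges_in G W)) addnC.
congr (_ + _); first by apply: eq_card => e; rewrite edges_inD1 !inE andbC.
rewrite -(@card_in_imset _ _ (fun u => [set v; u])) => [|a b _ _]; last first.
  by case/set2_or => -[] // -> ->.
apply: eq_card => e; rewrite inE inE.
apply/andP/imsetP => [[/edges_inP[a [b [Gab aW bW ->]]]]|[u]].
  by case/set2P => ->; [exists b|exists a]; rewrite ?inE ?aW ?bW 1?setUC // adj_sym.
by rewrite inE => /andP[uW Gvu] ->; rewrite set21 mem_edges_in2.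
Qed.

Lemma card_edges_in_le (T : finType) (G : sgraph T) (W : {set T}) :
  #|edges_in G W| <= 'C(#|W|, 2) ?= iff
  (edges_in G W == [set e : {set T} | e \subset W & #|e| == 2]).
Proof.
rewrite -cards_draws; apply: subset_leqif_cards; apply/subsetP => e.
case/edges_inP => a [b [Gab aW bW ->]].
by rewrite inE subUset !sub1set aW bW cards2 (adj_neq Gab).
Qed.

(** The new vertex [n] misses exactly the [n %/ r] earlier vertices of its residue class. *)
Lemma turan_numberS n r : 0 < r ->
  turan_number n.+1 r = turan_number n r + (n - n %/ r).
Proof.
move=> r0; rewrite /turan_number -edges_inT.
rewrite (card_edges_in _ (in_setT (@ord_max n))); congr (_ + _).
  pose w : 'I_n -> 'I_n.+1 := widen_ord (leqnSn n).
  have w_inj : injective w by move=> i j /(congr1 val) /= /val_inj.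
  rewrite -(card_imset (edges (turan_graph n r)) (imset_inj w_inj)).
  have w2 i j : w @: [set i; j] = [set w i; w j] by rewrite imsetU !imset_set1.
  have wK (i : 'I_n.+1) : i \in [set: 'I_n.+1] :\ ord_max -> exists j, i = w j.
    rewrite !inE andbT => ni; have lt_in : i < n.
      by have := ltn_ord i; rewrite ltnS leq_eqVlt => /orP[]// /eqP e;
         case/eqP: ni; apply: val_inj.
    by exists (Ordinal lt_in); apply: val_inj.
  apply: eq_card => e; apply/edges_inP/imsetP.
    case=> a [b [Gab /wK[i ai] /wK[j bj] ->]].
    exists [set i; j]; last by rewrite w2 ai bj.
    by rewrite mem_edges2; rewrite ai bj in Gab.
  case=> e' /edgesP[i [j [Gij ->]]] ->; exists (w i), (w j); split=> //.
  - by rewrite !inE andbT; apply/eqP => /(congr1 val) /= e1;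
       have := ltn_ord i; rewrite e1 ltnn.
  - by rewrite !inE andbT; apply/eqP => /(congr1 val) /= e1;
       have := ltn_ord j; rewrite e1 ltnn.
have := cardsC [set x : 'I_n.+1 | x %% r == n %% r].
rewrite card_turan_part ?ltn_pmod // card_ord.
rewrite [X in _ + X](_ : _ = #|nbr (turan_graph n.+1 r) setT ord_max|); last first.
  by apply: eq_card => x; rewrite !inE /= /turan_rel /= eq_sym.
suff -> : (n.+1 + (r.-1 - n %% r)) %/ r = (n %/ r).+1.
  by rewrite addSn => -[h]; rewrite -[X in X - _]h addKn.
have -> : n.+1 + (r.-1 - n %% r) = (n %/ r).+1 * r.
  have := divn_eq n r; have := ltn_pmod n r0; rewrite mulSn.
  by move: (n %/ r * r) (n %% r) => x i; lia.
by rewrite mulnK.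
Qed.

Lemma turan_number_small n r : 0 < r -> n <= r -> turan_number n r = 'C(n, 2).
Proof.
move=> r0; elim: n => [|n IHn] lt_nr.
  by apply/eqP; rewrite cards_eq0; apply/set0Pn => -[e /edgesP[[]]].
by rewrite turan_numberS // divn_small // subn0 IHn 1?ltnW // binS bin1.
Qed.

(** The vertices [r], [r + 1] and [r + 2] each miss exactly one earlier vertex, as [2 < r] keeps
    [(r + 2) %/ r = 1]. *)
Lemma turan_number_add3 r : 2 < r -> turan_number (r + 3) r + 3 = 'C(r + 3, 2).
Proof.
move=> r2; have r0 : 0 < r by lia.
have d j : j < r -> (r + j) %/ r = 1.
  by move=> jr; rewrite divnDl ?dvdnn // divnn r0 divn_small.
rewrite (addn3 r) !turan_numberS // turan_number_small //.
rewrite (binS r.+2) (binS r.+1) (binS r) !bin1.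
have := d 0 r0; have := d 1 (ltnW r2); have := d 2 r2.
rewrite addn0 addn1 addn2 => -> -> ->; lia.
Qed.

(** * Colours lost by deleting a vertex, and the base case *)

Lemma star_representatives (T C : finType) (G : sgraph T) (col : coloring T C)
    (W : {set T}) v : v \in W -> exists O : {set T},
  [/\ #|O| + #|col @: edges_in G (W :\ v)| = #|col @: edges_in G W|,
      O \subset nbr G W v,
      {in O &, forall u u', col [set v; u] = col [set v; u'] -> u = u'}
    & forall u a b, u \in O -> a \in W -> b \in W -> G a b ->
        col [set a; b] = col [set v; u] -> v \in [set a; b]].
Proof.
move=> vW.
(* [A] holds the colours lost with [v], those of classes whose edges all contain [v]. On [A] the
   search in [pk] succeeds, so its default is never taken there. *)
pose A := col @: edges_in G W :\: col @: edges_in G (W :\ v).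
pose pk c := odflt v [pick u in nbr G W v | col [set v; u] == c].
have pkP c : c \in A -> pk c \in nbr G W v /\ col [set v; pk c] = c.
  case/setDP => /imsetP[e eW ->] nc; rewrite /pk; case: pickP => [u /andP[? /eqP]|h] //.
  have : v \in e.
    apply: contraR nc => ve; apply/imset_f; rewrite edges_inD1.
    by rewrite inE eW.
  case/edges_inP: eW h nc => a [b [Gab aW bW ->]] h nc /set2P[ev|ev].
    by have := h b; rewrite ev eqxx inE bW Gab.
  by have := h a; rewrite ev setUC eqxx inE aW adj_sym Gab.
have pk_inj : {in A &, injective pk}.
  by move=> c d /pkP[_ {2}<-] /pkP[_ {2}<-] ->.
have sub : col @: edges_in G (W :\ v) \subset col @: edges_in G W.
  by apply/imsetS/subsetP => e; rewrite edges_inD1 inE => /andP[].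
exists (pk @: A); split.
- by rewrite card_in_imset // cardsD (setIidPr sub) subnK ?subset_leq_card.
- by apply/subsetP => u /imsetP[c /pkP[]] ? _ ->.
- move=> u u' /imsetP[c cA ->] /imsetP[d dA ->].
  by case: (pkP c cA) (pkP d dA) => [_ ->] [_ ->] ->.
- move=> u a b /imsetP[c cA ->] aW bW Gab; case: (pkP c cA) => _ -> E.
  case/setDP: cA => _; apply: contraR => vab.
  by rewrite -E; apply/imset_f; rewrite edges_inD1 inE vab mem_edges_in2.
Qed.

(** There is at most one more edge than colours, so [e1] and [e2] form the only repetition, and it
    is gone once an endpoint of [e1] is deleted. *)
Lemma rainbow_delete (T C : finType) (G : sgraph T) (col : coloring T C)
    (W e1 e2 : {set T}) v :
  (forall e : {set T}, e \subset W -> #|e| = 2 -> e \in edges G) ->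
  #|edges_in G W| <= #|col @: edges_in G W|.+1 ->
  e1 \in edges_in G W -> e2 \in edges_in G W -> e1 != e2 ->
  col e1 = col e2 -> v \in e1 -> rainbow G col (W :\ v).
Proof.
move=> complW ce e1W e2W ne E ve1.
have DW : {in W :\ v &, forall a b, a \in W /\ b \in W}.
  by move=> a b /setD1P[_ aW] /setD1P[_ bW].
split=> [a b aD bD ab|a b c d aD bD cD dD Gab Gcd Ecol].
  rewrite -mem_edges2; apply: complW; last by rewrite cards2 ab.
  by have [aW bW] := DW _ _ aD bD; rewrite subUset !sub1set aW.
have sub : col @: edges_in G W \subset col @: (edges_in G W :\ e1).
  apply/subsetP => _ /imsetP[e eW ->]; have [->|ee1] := eqVneq e e1.
    by rewrite E; apply/imset_f; rewrite in_setD1 eq_sym ne.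
  by apply/imset_f; rewrite in_setD1 ee1.
have inj : {in edges_in G W :\ e1 &, injective col}.
  apply/imset_injP; rewrite eqn_leq leq_imset_card /=.
  apply: leq_trans (subset_leq_card sub).
  by move: ce; rewrite (cardsD1 e1) e1W.
have inD x y : x \in W :\ v -> y \in W :\ v -> G x y ->
    [set x; y] \in edges_in G W :\ e1.
  move=> xD yD Gxy; have [xW yW] := DW _ _ xD yD.
  rewrite in_setD1 mem_edges_in2 // andbT; apply: contraTneq ve1 => <-.
  by move: xD yD; rewrite !inE ![_ == v]eq_sym => /andP[/negPf -> _] /andP[/negPf ->].
by apply: inj => //; apply: inD.
Qed.

(** The lower bound equals [2 * 'C(r + 3, 2) - 1], so all pairs are edges and at most one repetition
    of a colour occurs. Two one-vertex deletions then leave different rainbow cliques: any two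
    without a repetition, otherwise those of a vertex of [e1] outside [e2] and one of [e2] outside
    [e1]. *)
Lemma unique_rainbow_base (T C : finType) (G : sgraph T) (col : coloring T C)
    (W S0 : {set T}) r : 2 < r -> #|W| = r + 3 ->
  'C(r + 3, 2) + turan_number (r + 3) r + 2
    <= #|edges_in G W| + #|col @: edges_in G W| ->
  (forall S : {set T}, S \subset W -> #|S| = r.+2 -> rainbow G col S -> S = S0) ->
  False.
Proof.
move=> r2 cW bound uniqS; have tr := turan_number_add3 r2.
have cE := card_edges_in_le G W; rewrite cW in cE.
have cc := leq_imset_card col (edges_in G W).
have full : #|edges_in G W| = 'C(r + 3, 2).
  by move: cE.1 bound cc tr; clear; set c := #|_ @: _|; set e := #|_|; lia.
have ce : #|edges_in G W| <= #|col @: edges_in G W|.+1 by lia.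
have complW (e : {set T}) : e \subset W -> #|e| = 2 -> e \in edges G.
  move=> eW e2; have : e \in edges_in G W; last by rewrite inE => /andP[].
  by move: cE.2; rewrite full eqxx => /esym/eqP ->; rewrite inE eW e2 eqxx.
have two v u : v \in W -> u \in W -> v != u ->
    rainbow G col (W :\ v) -> rainbow G col (W :\ u) -> False.
  have cD w : w \in W -> #|W :\ w| = r.+2.
    by move=> wW; have := cardsD1 w W; rewrite wW cW; lia.
  move=> vW uW vu /uniqS h1 /uniqS h2; move: vu; apply/negP; rewrite negbK.
  have : u \notin W :\ v.
    by rewrite h1 ?subD1set ?cD // -h2 ?subD1set ?cD // !inE eqxx.
  by rewrite !inE uW andbT negbK eq_sym.
have [inj|] := boolP (dinjectiveb col (edges_in G W)).
  have [v vW] : exists v, v \in W by apply/set0Pn; rewrite -card_gt0 cW; lia.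
  have [u] : exists u, u \in W :\ v.
    by apply/set0Pn; rewrite -card_gt0; have := cardsD1 v W; rewrite vW cW; lia.
  rewrite !inE => /andP[uv uW].
  have rD w : rainbow G col (W :\ w).
    have DW a : a \in W :\ w -> a \in W by case/setD1P.
    split=> [a b /DW aW /DW bW ab|a b c d /DW aW /DW bW /DW cW' /DW dW Gab Gcd].
      by rewrite -mem_edges2 complW ?cards2 ?ab // subUset !sub1set aW.
    by apply: (dinjectiveP _ _ inj); apply: mem_edges_in2.
  by apply: (two v u) => //; rewrite eq_sym.
case/dinjectivePn => e1 e1W [e2]; rewrite inE => /andP[/= ne e2W] E.
have card2 (e : {set T}) : e \in edges_in G W -> #|e| = 2.
  by case/edges_inP => a [b [Gab _ _ ->]]; rewrite cards2 (adj_neq Gab).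
have diff (e e' : {set T}) : e \in edges_in G W -> e' \in edges_in G W ->
    e != e' -> exists v, [/\ v \in e, v \notin e' & v \in W].
  move=> eW e'W nee; have /subsetPn[v ve ve'] : ~~ (e \subset e').
    apply: contra nee => sub; rewrite eqEcard sub !card2 //.
  exists v; split=> //; move: eW; rewrite inE => /andP[_ /subsetP]; exact.
have [v [ve1 nve2 vW]] := diff _ _ e1W e2W ltac:(by rewrite eq_sym).
have [u [ue2 nue1 uW]] := diff _ _ e2W e1W ne.
apply: (two v u) => //; first by apply: contraNneq nue1 => <-.
  by apply: (rainbow_delete complW ce e1W e2W) => //; rewrite eq_sym.
by apply: (rainbow_delete complW ce e2W e1W).
Qed.

(** * The induction on the number of vertices *)

Lemma not_unique_rainbow (T C : finType) (G : sgraph T) (col : coloring T C)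
    r n (W S0 : {set T}) : 2 < r -> #|W| = n -> r + 3 <= n ->
  'C(n, 2) + turan_number n r + 2
    <= #|edges_in G W| + #|col @: edges_in G W| ->
  (forall S : {set T}, S \subset W -> #|S| = r.+2 -> rainbow G col S -> S = S0) ->
  False.
Proof.
move=> r2; elim: n W => [|n IHn] W cW rn; first by lia.
have [eqn bound|nen bound uniqS] := eqVneq (r + 3) n.+1.
  by apply: (@unique_rainbow_base _ _ G col W S0 r r2); rewrite eqn.
have r0 : 0 < r by lia.
have {}rn : r + 3 <= n by lia.
have cD v : v \in W -> #|W :\ v| = n.
  by move=> vW; have := cardsD1 v W; rewrite vW cW; lia.
pose bounded v := 'C(n, 2) + turan_number n r + 2
    <= #|edges_in G (W :\ v)| + #|col @: edges_in G (W :\ v)|.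
have [/exists_inP[v vW vb]|] := boolP [exists v in W, bounded v].
  apply: (IHn (W :\ v)) => // [|S SD]; first exact: cD.
  by apply: uniqS; apply: subset_trans SD (subD1set _ _).
rewrite negb_exists_in => /forall_inP nb.
pose reps v (Ov : {set T}) :=
  [/\ #|Ov| + #|col @: edges_in G (W :\ v)| = #|col @: edges_in G W|,
      Ov \subset nbr G W v,
      {in Ov &, forall u u', col [set v; u] = col [set v; u'] -> u = u'}
    & forall u a b, u \in Ov -> a \in W -> b \in W -> G a b ->
        col [set a; b] = col [set v; u] -> v \in [set a; b]].
(* [O] is empty outside [W], so that membership in [O v] alone gives [v \in W]. *)
have [O OP] : exists O : T -> {set T},
    forall v, (v \in W -> reps v (O v)) /\ (v \notin W -> O v = set0).
  apply: (@fin_all_exists T (fun=> {set T})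
    (fun v Ov => (v \in W -> reps v Ov) /\ (v \notin W -> Ov = set0))) => v.
  have [vW|vW] := boolP (v \in W).
    by have [O h] := star_representatives G col vW; exists O.
  by exists set0.
have OW v u : u \in O v -> v \in W.
  by apply: contraLR => /(OP v).2 ->; rewrite inE.
have O_adj v u : u \in O v -> [/\ v \in W, u \in W & G v u].
  move=> uO; have vW := OW _ _ uO; have [_ /subsetP /(_ u uO)] := (OP v).1 vW.
  by rewrite inE => /andP[].
(* The clique [K] must start at a vertex outside the excluded set. If [S0] covers [W], it has more
   than [r.+2] elements, so no clique in question equals it and [set0] can replace it. *)
have [S1 [v vW vS1] uniqS1] : exists2 S1 : {set T}, exists2 v, v \in W & v \notin S1 &
    forall S : {set T}, S \subset W -> #|S| = r.+2 -> rainbow G col S -> S = S1.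
  have [WS0|/subsetPn ?] := boolP (W \subset S0); last by exists S0.
  have [v vW] : exists v, v \in W by apply/set0Pn; rewrite -card_gt0 cW.
  exists set0; first by exists v; rewrite ?inE.
  move=> S SW cS /(uniqS S SW cS) eS.
  by have := subset_leq_card WS0; rewrite -eS cS cW; lia.
have nr : 0 < n %/ r by rewrite divn_gt0 //; lia.
apply: (@unique_rainbow_contra _ _ G col W O O_adj _ _ r (n %/ r).-1 (n %% r)
          r2 _ _ _ S1 v vW vS1 uniqS1).
- move=> x u a b uO; have xW := OW _ _ uO; have [_ _ _ h] := (OP x).1 xW.
  exact: h.
- move=> x u u' uO; have xW := OW _ _ uO; have [_ _ h _] := (OP x).1 xW.
  exact: h.
- by rewrite prednK // mulnC -divn_eq.
- move: rn nr (divn_eq n r); clear.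
  by case: (n %/ r) => [|[|q]] // rn _; rewrite mul1n => e; lia.
(* From [n] to [n.+1] vertices the bound grows by [n + (n - n %/ r)], and a failed deletion falls
   short by at least one more, whence the defect [n %/ r - 1]. *)
move=> x xW; have [cO _ _ _] := (OP x).1 xW.
have := nb x xW; rewrite /bounded -ltnNge cW /=.
move: bound; rewrite (card_edges_in _ xW) -cO turan_numberS // binS bin1.
have : n %/ r <= n by apply: leq_div.
move: nr; clear; move: (n %/ r) (turan_number n r) => q t.
by move: #|_ @: _| #|edges_in _ _| #|nbr _ _ _| #|O x| => c e d o; lia.
Qed.

(** * From arbitrary colours to a finite type of colours *)

Lemma size_undup_map (A : eqType) (C C' : eqType) (f : A -> C) (g : A -> C') s :
  {in s &, forall x y, (f x == f y) = (g x == g y)} ->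
  size (undup (map f s)) = size (undup (map g s)).
Proof.
elim: s => //= x s IHs fg.
have -> : (f x \in map f s) = (g x \in map g s).
  apply/mapP/mapP => -[y ys /eqP e]; exists y => //; apply/eqP.
    by rewrite -fg ?mem_head // in_cons ys orbT.
  by rewrite fg ?mem_head // in_cons ys orbT.
have {}IHs := IHs (sub_in2 (fun y ys => mem_behead (s := x :: s) ys) fg).
by case: ifP => _ /=; rewrite IHs.
Qed.

Theorem theorem5 (T : finType) (C : eqType) (G : sgraph T)
    (col : coloring T C) (n k : nat)
    (hn : #|T| = n)
    (hk : (6 <= k /\ k < n) \/ (k = 5 /\ 10 <= n))
    (hG : 'C(n, 2) + turan_number n (k - 2) + 2
          <= #|edges G| + num_colors G col) :
  2 <= #|[set S : {set T} | rainbow_clique G col k S]|.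
Proof.
(* a colour is replaced by its class, which lives in a finite type *)
pose kappa (e : {set T}) := [set e' | col e' == col e].
have kappaE e e' : (col e == col e') = (kappa e == kappa e').
  apply/eqP/eqP => [E|/setP /(_ e)]; first by apply/setP => x; rewrite !inE E.
  by rewrite !inE eqxx => /esym/eqP.
have colors : num_colors G col = #|kappa @: edges G|.
  rewrite /num_colors (size_undup_map (g := kappa)) => [|e e' _ _]; last exact: kappaE.
  by rewrite -(card_uniqP (undup_uniq _)) imset_card; apply: eq_card => x; rewrite mem_undup.
have rbW (S : {set T}) : #|S| = k -> rainbow G kappa S -> rainbow_clique G col k S.
  move=> cS [adjS injS]; rewrite /rainbow_clique cS eqxx /=; apply/andP; split.
    apply/forall_inP => x xS; apply/forall_inP => y yS; apply/implyP; exact: adjS.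
  apply/dinjectiveP => e e'; rewrite ![_ \in [set _ in _ | _]]inE => He He'.
  have /edges_inP[a [b [Gab aS bS ->]]] : e \in edges_in G S by rewrite inE.
  have /edges_inP[c [d [Gcd cS' dS ->]]] : e' \in edges_in G S by rewrite inE.
  by move/eqP; rewrite kappaE => /eqP; apply: injS.
rewrite leqNgt; apply/negP => few.
(* Fewer than two rainbow cliques all equal one set [S0]; if there are none, any set serves. *)
have [S0 uniqS] : exists S0 : {set T}, forall S : {set T},
    rainbow_clique G col k S -> S = S0.
  have [e|/set0Pn[S0]] := eqVneq [set S : {set T} | rainbow_clique G col k S] set0.
    by exists set0 => S h; have := in_set0 S; rewrite -e inE h.
  move=> S0in; exists S0 => S h.
  by apply: (card_le1_eqP few) => //; rewrite inE.
apply: (@not_unique_rainbow T _ G kappa (k - 2) n setT S0).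
- by case: hk; lia.
- by rewrite cardsT.
- by case: hk; lia.
- by rewrite edges_inT -colors.
- move=> S _ cS /rbW h; apply/uniqS/h; rewrite cS; case: hk; lia.
Qed.
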